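(* Let $\mathcal{C}$ be an additive symmetric monoidal category with finite coproducts for which the symmetric algebra monad $\mathsf{S}$ on $\mathcal{C}$ exists. Assume that $\mathcal{C}$ has reflexive coequalizers and that these are preserved by the tensor product in each variable. Then to equip $\mathcal{C}$ with the structure of a codifferential category is, equivalently, to equip $\mathcal{C}$ with 1. a monad $T$, 2. a monad morphism $\lambda:\mathsf{S}\to T$, and 3. a transformation $d_{TC}:TC\to TC\otimes C$ natural in $C\in\mathcal{C}$, such that (a) for each $C\in\mathcal{C}$, $\lambda_C;d_{TC}=d_{SC};(\lambda_C\otimes 1_C):SC\to TC\otimes C$, where $d_{SC}$ is the deriving transform carried by $\mathsf{S}$, and (b) the Chain Rule $\mu_C;d_{TC}=d_{T^2C};(\mu_C\otimes d_{TC});(m_{TC}\otimes 1_C)$ holds for each $C\in\mathcal{C}$ (i.e. each $d_{TC}$ is a $T$-derivation). Here algebra modalities $(T,m,e)$ correspond to pairs $(T,\lambda)$ under the canonical bijection, and the transformation $d$ is the same on both sides.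
   Context: Composition is written in diagrammatic order: $f;g$ means first $f$, then $g$. Monoidal structures are written as if strict, with unit $k$ and symmetry $c$. An additive symmetric monoidal category is a symmetric monoidal category enriched over commutative monoids (hom-sets have addition and zero, composition is bilinear) whose tensor functor is additive in both variables. In such a category finite coproducts are biproducts, written $\oplus$, with pairing $\langle f,g\rangle$. A commutative algebra is a commutative monoid object $(A,m_A,e_A)$; modules are left modules. An algebra modality consists of a monad $(T,\mu,\eta)$ and, for each object $C$, morphisms $m:TC\otimes TC\to TC$, $e:k\to TC$ making $TC$ a commutative algebra, such that $m,e$ are natural in $C$ and each $\mu_C:T^2C\to TC$ is an algebra homomorphism. A codifferential category is an additive symmetric monoidal category with an algebra modality $T$ and a transformation $d_{TC}:TC\to TC\otimes C$, natural in $C$, such that: (d1) $e;d=0$; (d2) $m;d=(1\otimes d);(m\otimes 1)+(d\otimes 1);c;(m\otimes 1)$, where $c$ here is the symmetry $TC\otimes C\otimes TC\to TC\otimes TC\otimes C$; (d3) $\eta;d=e\otimes 1$; (d4, Chain Rule) $\mu_C;d_{TC}=d_{T^2C};(\mu_C\otimes d_{TC});(m\otimes 1_C)$. Symmetric algebra monad: let $Alg$ be the category of commutative algebras in $\mathcal{C}$; ''the symmetric algebra monad exists'' means that the forgetful functor $Alg\to\mathcal{C}$ has a left adjoint, and $\mathsf{S}=(S,\eta^{\mathsf S},\mu^{\mathsf S})$ is the induced monad. Under the assumptions of the claim, $Alg\to\mathcal{C}$ is monadic and $Alg$ is identified with the category of $\mathsf{S}$-algebras. Its deriving transform $d_{SC}:SC\to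 SC\otimes C$ is the morphism for which $\langle 1_{SC},d_{SC}\rangle:SC\to SC\oplus(SC\otimes C)$ is the unique algebra homomorphism whose composite with $\eta^{\mathsf S}_C$ is $\langle\eta^{\mathsf S}_C,e\otimes 1_C\rangle$; here, for a commutative algebra $A$ and an $A$-module $M$ with action $\bullet$, $A\oplus M$ has multiplication with components $(\pi_1\otimes\pi_1);m_A$ and $(\pi_1\otimes\pi_2);\bullet+c;(\pi_1\otimes\pi_2);\bullet$, and unit $\langle e_A,0\rangle$, and $SC\otimes C$ is the free $SC$-module on $C$. Canonical bijection between algebra modalities and pairs $(T,\lambda)$ ($T$ a monad on $\mathcal{C}$, $\lambda:\mathsf{S}\to T$ a monad morphism): given $\lambda$, each $T$-algebra $(A,a)$ becomes an $\mathsf{S}$-algebra $(A,\lambda_A;a)$, i.e. a commutative algebra, and in particular each $(TC,\mu_C)$ yields a commutative algebra $(TC,m_{TC},e_{TC})$; given an algebra modality, $\lambda_C:SC\to TC$ is the unique algebra homomorphism with $\eta^{\mathsf S}_C;\lambda_C=\eta^T_C$. In the setting of a symmetric monoidal category with an algebra modality $T$ and morphisms $d_{TC}:TC\to TC\otimes C$, a $T$-derivation from a $T$-algebra $(A,\nu)$ to a module $M$ over its associated algebra (multiplication $(\eta_A\otimes\eta_A);m;\nu$, unit $e;\nu$) is a morphism $\partial:A\to M$ with $\nu;\partial=d_{TA};(\nu\otimes\partial);\bullet_M$. *)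

(* Defs.v *)
From mathcomp Require Import ssreflect ssrfun.
From Stdlib Require Import ProofIrrelevance.

Set Implicit Arguments.
Unset Strict Implicit.
Unset Printing Implicit Defensive.

Declare Scope cat_scope.
Local Open Scope cat_scope.

Reserved Notation "A ~> B" (at level 70, no associativity).
Reserved Notation "f ;; g" (at level 45, left associativity).
Reserved Notation "A ⊗ B" (at level 40, left associativity).
Reserved Notation "f ⊗₁ g" (at level 40, left associativity).
Reserved Notation "f ⊞ g" (at level 50, left associativity).

Record category := Category {
  obj :> Type;
  hom : obj -> obj -> Type;
  idc : forall A, hom A A;
  comp : forall A B C, hom A B -> hom B C -> hom A C;
  comp1c : forall A B (f : hom A B), comp (idc A) f = f;
  compc1 : forall A B (f : hom A B), comp f (idc B) = f;
  compA : forall A B C D (f : hom A B) (g : hom B C) (h : hom C D),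
    comp f (comp g h) = comp (comp f g) h }.

Arguments hom {c} A B.
Arguments idc {c} A.
Arguments comp {c A B C} f g.
Arguments comp1c {c A B} f.
Arguments compc1 {c A B} f.
Arguments compA {c A B C D} f g h.

Notation "A ~> B" := (hom A B) : cat_scope.
(* Diagrammatic order: first [f], then [g]. *)
Notation "f ;; g" := (comp f g) : cat_scope.

Record functor (C D : category) := Functor {
  fobj :> C -> D;
  fmap : forall A B : C, A ~> B -> fobj A ~> fobj B;
  fmap1 : forall A : C, fmap (idc A) = idc (fobj A);
  fmapM : forall (A B E : C) (f : A ~> B) (g : B ~> E),
    fmap (f ;; g) = fmap f ;; fmap g }.

Arguments fmap {C D} f {A B} f0 : rename.

Definition id_functor (C : category) : functor C C :=
  @Functor C C (fun A => A) (fun A B f => f)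
    (fun A => erefl) (fun A B E f g => erefl).

Definition comp_functor (C D E : category) (F : functor C D) (G : functor D E) :
  functor C E.
Proof.
apply: (@Functor C E (fun A => G (F A)) (fun A B f => fmap G (fmap F f))).
- by move=> A; rewrite !fmap1.
- by move=> A B X f g; rewrite !fmapM.
Defined.

Definition natural (C D : category) (F G : functor C D)
    (t : forall A : C, F A ~> G A) : Prop :=
  forall (A B : C) (f : A ~> B), fmap F f ;; t B = t A ;; fmap G f.

Record monad (C : category) := Monad {
  mon_fun :> functor C C;
  mon_eta : forall A : C, A ~> mon_fun A;
  mon_mu : forall A : C, mon_fun (mon_fun A) ~> mon_fun A;
  mon_eta_nat : natural (F := id_functor C) (G := mon_fun) mon_eta;
  mon_mu_nat :
    natural (F := comp_functor mon_fun mon_fun) (G := mon_fun) mon_mu;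
  mon_unit_l : forall A : C, mon_eta (mon_fun A) ;; mon_mu A = idc _;
  mon_unit_r : forall A : C, fmap mon_fun (mon_eta A) ;; mon_mu A = idc _;
  mon_assoc : forall A : C,
    mon_mu (mon_fun A) ;; mon_mu A = fmap mon_fun (mon_mu A) ;; mon_mu A }.

Arguments mon_eta {C} m A.
Arguments mon_mu {C} m A.

Record monad_morphism (C : category) (S T : monad C) := MonadMorphism {
  mm_map :> forall A : C, S A ~> T A;
  mm_nat : natural mm_map;
  mm_eta : forall A : C, mon_eta S A ;; mm_map A = mon_eta T A;
  mm_mu : forall A : C,
    mon_mu S A ;; mm_map A =
    mm_map (S A) ;; fmap T (mm_map A) ;; mon_mu T A }.

Record monad_algebra (C : category) (T : monad C) := MonadAlgebra {
  ta_car :> C;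
  ta_act : T ta_car ~> ta_car;
  ta_unit : mon_eta T ta_car ;; ta_act = idc _;
  ta_mult : mon_mu T ta_car ;; ta_act = fmap T ta_act ;; ta_act }.

Lemma monad_algebra_eq (C : category) (T : monad C) (A : C) (a a' : T A ~> A)
    u m u' m' : a = a' ->
  @MonadAlgebra C T A a u m = @MonadAlgebra C T A a' u' m'.
Proof.
by move=> e; move: u' m'; rewrite -e => u' m'; congr MonadAlgebra;
  exact: proof_irrelevance.
Qed.

Record adjunction (C D : category) (F : functor C D) (U : functor D C) :=
  Adjunction {
  adj_unit : forall A : C, A ~> U (F A);
  adj_counit : forall X : D, F (U X) ~> X;
  adj_unit_nat :
    natural (F := id_functor C) (G := comp_functor F U) adj_unit;
  adj_counit_nat :
    natural (F := comp_functor U F) (G := id_functor D) adj_counit;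
  adj_triangle_F : forall A : C, fmap F (adj_unit A) ;; adj_counit (F A) = idc _;
  adj_triangle_U : forall X : D, adj_unit (U X) ;; fmap U (adj_counit X) = idc _ }.

Definition adjunction_monad (C D : category) (F : functor C D) (U : functor D C)
  (adj : adjunction F U) : monad C.
Proof.
apply: (@Monad C (comp_functor F U) (adj_unit adj)
          (fun A => fmap U (adj_counit adj (F A)))).
- exact: adj_unit_nat.
- move=> A B f /=; rewrite -!fmapM; congr (fmap U _).
  exact: (adj_counit_nat adj).
- move=> A; exact: (adj_triangle_U adj (F A)).
- by move=> A /=; rewrite -fmapM adj_triangle_F fmap1.
- move=> A /=; rewrite -!fmapM; congr (fmap U _).
  exact: (esym (adj_counit_nat adj (adj_counit adj (F A)))).
Defined.

Record finite_coproducts (C : category) := FiniteCoproducts {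
  initial : C;
  from_initial : forall A : C, initial ~> A;
  from_initial_uniq : forall (A : C) (f : initial ~> A), f = from_initial A;
  coprod : C -> C -> C;
  inl_c : forall A B : C, A ~> coprod A B;
  inr_c : forall A B : C, B ~> coprod A B;
  copair : forall A B X : C, A ~> X -> B ~> X -> coprod A B ~> X;
  inl_copair : forall (A B X : C) (f : A ~> X) (g : B ~> X),
    inl_c A B ;; copair f g = f;
  inr_copair : forall (A B X : C) (f : A ~> X) (g : B ~> X),
    inr_c A B ;; copair f g = g;
  copair_uniq : forall (A B X : C) (h : coprod A B ~> X),
    h = copair (inl_c A B ;; h) (inr_c A B ;; h) }.

Arguments coprod {C} f A B : rename.
Arguments inl_c {C} f A B : rename.
Arguments inr_c {C} f A B : rename.
Arguments copair {C} f0 {A B X} f g : rename.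

Definition is_reflexive_pair (C : category) (A B : C) (f g : A ~> B) : Prop :=
  exists s : B ~> A, s ;; f = idc B /\ s ;; g = idc B.

Definition is_coequalizer (C : category) (A B Q : C) (f g : A ~> B)
    (q : B ~> Q) : Prop :=
  f ;; q = g ;; q /\
  forall (X : C) (h : B ~> X), f ;; h = g ;; h -> exists! u : Q ~> X, q ;; u = h.

Definition has_reflexive_coequalizers (C : category) : Prop :=
  forall (A B : C) (f g : A ~> B), is_reflexive_pair f g ->
    exists (Q : C) (q : B ~> Q), is_coequalizer f g q.

Record symmetric_monoidal := SymmetricMonoidal {
  smc_cat :> category;
  ten : smc_cat -> smc_cat -> smc_cat;
  tenf : forall A A' B B' : smc_cat, A ~> A' -> B ~> B' -> ten A B ~> ten A' B';
  ten1 : forall A B : smc_cat, tenf (idc A) (idc B) = idc (ten A B);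
  tenM : forall (A A' A'' B B' B'' : smc_cat) (f : A ~> A') (f' : A' ~> A'')
           (g : B ~> B') (g' : B' ~> B''),
    tenf (f ;; f') (g ;; g') = tenf f g ;; tenf f' g';
  kk : smc_cat;
  asc : forall A B C : smc_cat, ten (ten A B) C ~> ten A (ten B C);
  asci : forall A B C : smc_cat, ten A (ten B C) ~> ten (ten A B) C;
  lun : forall A : smc_cat, ten kk A ~> A;
  luni : forall A : smc_cat, A ~> ten kk A;
  run : forall A : smc_cat, ten A kk ~> A;
  runi : forall A : smc_cat, A ~> ten A kk;
  sym : forall A B : smc_cat, ten A B ~> ten B A;
  ascK : forall A B C : smc_cat, asc A B C ;; asci A B C = idc _;
  asciK : forall A B C : smc_cat, asci A B C ;; asc A B C = idc _;
  lunK : forall A : smc_cat, lun A ;; luni A = idc _;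
  luniK : forall A : smc_cat, luni A ;; lun A = idc _;
  runK : forall A : smc_cat, run A ;; runi A = idc _;
  runiK : forall A : smc_cat, runi A ;; run A = idc _;
  symK : forall A B : smc_cat, sym A B ;; sym B A = idc _;
  asc_nat : forall (A A' B B' C C' : smc_cat)
      (f : A ~> A') (g : B ~> B') (h : C ~> C'),
    tenf (tenf f g) h ;; asc A' B' C' = asc A B C ;; tenf f (tenf g h);
  lun_nat : forall (A B : smc_cat) (f : A ~> B),
    tenf (idc kk) f ;; lun B = lun A ;; f;
  run_nat : forall (A B : smc_cat) (f : A ~> B),
    tenf f (idc kk) ;; run B = run A ;; f;
  sym_nat : forall (A A' B B' : smc_cat) (f : A ~> A') (g : B ~> B'),
    tenf f g ;; sym A' B' = sym A B ;; tenf g f;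
  pentagon : forall A B C D : smc_cat,
    asc (ten A B) C D ;; asc A B (ten C D) =
    tenf (asc A B C) (idc D) ;; asc A (ten B C) D ;; tenf (idc A) (asc B C D);
  triangle : forall A B : smc_cat,
    asc A kk B ;; tenf (idc A) (lun B) = tenf (run A) (idc B);
  hexagon : forall A B C : smc_cat,
    asc A B C ;; sym A (ten B C) ;; asc B C A =
    tenf (sym A B) (idc C) ;; asc B A C ;; tenf (idc B) (sym A C);
  sym_unit : forall A : smc_cat, sym A kk ;; lun A = run A }.

Arguments kk {s}.
Arguments ten {s} A B.
Arguments tenf {s A A' B B'} f g.
Arguments asc {s} A B C.
Arguments asci {s} A B C.
Arguments lun {s} A.
Arguments luni {s} A.
Arguments run {s} A.
Arguments runi {s} A.
Arguments sym {s} A B.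

Notation "A ⊗ B" := (ten A B) : cat_scope.
Notation "f ⊗₁ g" := (tenf f g) : cat_scope.

Record additive_smc := AdditiveSmc {
  asmc_smc :> symmetric_monoidal;
  zeroh : forall A B : asmc_smc, A ~> B;
  addh : forall A B : asmc_smc, A ~> B -> A ~> B -> A ~> B;
  addhA : forall (A B : asmc_smc) (f g h : A ~> B),
    addh f (addh g h) = addh (addh f g) h;
  addhC : forall (A B : asmc_smc) (f g : A ~> B), addh f g = addh g f;
  add0h : forall (A B : asmc_smc) (f : A ~> B), addh (zeroh A B) f = f;
  comp0h : forall (A B C : asmc_smc) (f : B ~> C), zeroh A B ;; f = zeroh A C;
  comph0 : forall (A B C : asmc_smc) (f : A ~> B), f ;; zeroh B C = zeroh A C;
  compDh : forall (A B C : asmc_smc) (f g : A ~> B) (h : B ~> C),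
    addh f g ;; h = addh (f ;; h) (g ;; h);
  comphD : forall (A B C : asmc_smc) (f : A ~> B) (g h : B ~> C),
    f ;; addh g h = addh (f ;; g) (f ;; h);
  ten0h : forall (A A' B B' : asmc_smc) (g : B ~> B'),
    zeroh A A' ⊗₁ g = zeroh (A ⊗ B) (A' ⊗ B');
  tenh0 : forall (A A' B B' : asmc_smc) (f : A ~> A'),
    f ⊗₁ zeroh B B' = zeroh (A ⊗ B) (A' ⊗ B');
  tenDh : forall (A A' B B' : asmc_smc) (f g : A ~> A') (h : B ~> B'),
    addh f g ⊗₁ h = addh (f ⊗₁ h) (g ⊗₁ h);
  tenhD : forall (A A' B B' : asmc_smc) (f : A ~> A') (g h : B ~> B'),
    f ⊗₁ addh g h = addh (f ⊗₁ g) (f ⊗₁ h) }.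

Arguments zeroh {a A B}.
Arguments addh {a A B} f g.
Notation "f ⊞ g" := (addh f g) : cat_scope.

Definition tensor_preserves_reflexive_coequalizers (C : symmetric_monoidal) :
    Prop :=
  forall (A B Q : C) (f g : A ~> B) (q : B ~> Q),
    is_reflexive_pair f g -> is_coequalizer f g q ->
    forall X : C,
      is_coequalizer (idc X ⊗₁ f) (idc X ⊗₁ g) (idc X ⊗₁ q) /\
      is_coequalizer (f ⊗₁ idc X) (g ⊗₁ idc X) (q ⊗₁ idc X).

Section SmcFacts.
Variable C : symmetric_monoidal.
Implicit Types A B D E X Y Z : C.

Lemma tenf_l A A' A'' B B' (f : A ~> A') (f' : A' ~> A'') (g : B ~> B') :
  (f ;; f') ⊗₁ g = (f ⊗₁ idc B) ;; (f' ⊗₁ g).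
Proof. by rewrite -tenM comp1c. Qed.

Lemma tenf_r A A' B B' B'' (f : A ~> A') (g : B ~> B') (g' : B' ~> B'') :
  f ⊗₁ (g ;; g') = (idc A ⊗₁ g) ;; (f ⊗₁ g').
Proof. by rewrite -tenM comp1c. Qed.

Lemma asci_nat A A' B B' D D' (f : A ~> A') (g : B ~> B') (h : D ~> D') :
  (f ⊗₁ (g ⊗₁ h)) ;; asci A' B' D' = asci A B D ;; ((f ⊗₁ g) ⊗₁ h).
Proof.
by rewrite -[LHS]comp1c -asciK -compA [asc _ _ _ ;; _]compA -asc_nat -!compA
  ascK compc1.
Qed.

Lemma unit_faithful A B (f g : A ~> B) :
  idc kk ⊗₁ f = idc kk ⊗₁ g -> f = g.
Proof.
move=> fg; rewrite -[f]comp1c -[g]comp1c -luniK -!compA.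
by rewrite -!lun_nat fg.
Qed.

Lemma asc_lun A B : asc kk A B ;; lun (A ⊗ B) = lun A ⊗₁ idc B.
Proof.
apply: unit_faithful.
have asc_epi X Y Z W (u v : X ⊗ (Y ⊗ Z) ~> W) :
    asc X Y Z ;; u = asc X Y Z ;; v -> u = v.
  by move=> e; rewrite -[u]comp1c -[v]comp1c -asciK -!compA e.
have asc1_epi X Y Z V W (u v : (X ⊗ (Y ⊗ Z)) ⊗ V ~> W) :
    (asc X Y Z ⊗₁ idc V) ;; u = (asc X Y Z ⊗₁ idc V) ;; v -> u = v.
  move=> e; rewrite -[u]comp1c -[v]comp1c -ten1 -asciK tenf_l -!compA.
  by rewrite e.
apply: asc_epi; apply: asc1_epi.
rewrite tenf_r !compA -pentagon -compA triangle -ten1 -asc_nat.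
by rewrite -triangle tenf_l -compA asc_nat compA.
Qed.

Lemma sym_hex A B D :
  sym (A ⊗ B) D =
  asc A B D ;; (idc A ⊗₁ sym B D) ;; asci A D B ;; (sym A D ⊗₁ idc B) ;;
  asc D A B.
Proof.
have inv X Y (u : X ~> Y) (v w : Y ~> X) :
    u ;; v = idc X -> w ;; u = idc Y -> w = v.
  by move=> uv wu; rewrite -[w]compc1 -uv compA wu comp1c.
apply: (inv _ _ (sym D (A ⊗ B))); last exact: symK.
have -> : sym D (A ⊗ B) =
    asci D A B ;; (sym D A ⊗₁ idc B) ;; asc A D B ;; (idc A ⊗₁ sym D B) ;;
    asci A B D.
  rewrite -[sym D _]comp1c -asciK -[sym D _]compc1 -ascK !compA.
  congr (_ ;; _); rewrite -!compA; congr (_ ;; _); rewrite !compA.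
  exact: hexagon.
have cut X Y Z W (u : X ~> Y) (v : Y ~> Z) (w : Z ~> Y) (z : Y ~> W) :
   v ;; w = idc _ -> u ;; v ;; w ;; z = u ;; z.
  by move=> vw; rewrite -(compA u) vw compc1.
rewrite !compA (cut _ _ _ _ _ (asci A B D)) ?asciK //.
rewrite (cut _ _ _ _ _ (_ ⊗₁ sym D B)); last by rewrite -tenM symK comp1c ten1.
rewrite (cut _ _ _ _ _ (asc A D B)) ?ascK //.
rewrite (cut _ _ _ _ _ (sym D A ⊗₁ _)); last by rewrite -tenM symK comp1c ten1.
by rewrite asciK.
Qed.

End SmcFacts.

Section Biproducts.
Variables (C : additive_smc) (P : finite_coproducts C).
Implicit Types A B X : C.

(* By additivity the binary coproduct is also a product, hence a biproduct:
   see [pair_proj1], [pair_proj2] and [pair_ext]. *)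
Definition proj1_c A B : coprod P A B ~> A := copair P (idc A) zeroh.
Definition proj2_c A B : coprod P A B ~> B := copair P zeroh (idc B).
Definition pair_c X A B (f : X ~> A) (g : X ~> B) : X ~> coprod P A B :=
  (f ;; inl_c P A B) ⊞ (g ;; inr_c P A B).

Lemma addh0 A B (f : A ~> B) : f ⊞ zeroh = f.
Proof. by rewrite addhC add0h. Qed.

Lemma pair_proj1 X A B (f : X ~> A) (g : X ~> B) :
  pair_c f g ;; proj1_c A B = f.
Proof.
by rewrite /pair_c /proj1_c compDh -!compA inl_copair inr_copair compc1 comph0
  addh0.
Qed.

Lemma pair_proj2 X A B (f : X ~> A) (g : X ~> B) :
  pair_c f g ;; proj2_c A B = g.
Proof.
by rewrite /pair_c /proj2_c compDh -!compA inl_copair inr_copair compc1 comph0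
  add0h.
Qed.

Lemma pair_eta X A B (h : X ~> coprod P A B) :
  h = pair_c (h ;; proj1_c A B) (h ;; proj2_c A B).
Proof.
rewrite /pair_c -!compA -comphD -[LHS]compc1; congr (_ ;; _).
rewrite [LHS]copair_uniq [RHS]copair_uniq /proj1_c /proj2_c; congr copair.
  by rewrite comphD !compA !inl_copair comp1c compc1 comp0h addh0.
by rewrite comphD !compA !inr_copair comp1c compc1 comp0h add0h.
Qed.

Lemma pair_ext X A B (h h' : X ~> coprod P A B) :
  h ;; proj1_c A B = h' ;; proj1_c A B ->
  h ;; proj2_c A B = h' ;; proj2_c A B -> h = h'.
Proof. by move=> e1 e2; rewrite (pair_eta h) (pair_eta h') e1 e2. Qed.

End Biproducts.

Record comalg_on (C : symmetric_monoidal) (A : C) := ComalgOn {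
  alg_m : A ⊗ A ~> A;
  alg_e : kk ~> A;
  alg_mA : asc A A A ;; (idc A ⊗₁ alg_m) ;; alg_m = (alg_m ⊗₁ idc A) ;; alg_m;
  alg_1m : (alg_e ⊗₁ idc A) ;; alg_m = lun A;
  alg_m1 : (idc A ⊗₁ alg_e) ;; alg_m = run A;
  alg_mC : sym A A ;; alg_m = alg_m }.

Record comalg (C : symmetric_monoidal) := Comalg {
  calg_car :> C;
  calg_str :> comalg_on calg_car }.

Definition is_alg_hom (C : symmetric_monoidal) (A B : C) (a : comalg_on A)
    (b : comalg_on B) (f : A ~> B) : Prop :=
  alg_m a ;; f = (f ⊗₁ f) ;; alg_m b /\ alg_e a ;; f = alg_e b.

Section AlgFacts.
Variable C : symmetric_monoidal.

Lemma is_alg_hom_id (A : C) (a : comalg_on A) : is_alg_hom a a (idc A).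
Proof. by split; rewrite ?ten1 compc1 ?comp1c. Qed.

Lemma is_alg_hom_comp (A B D : C) (a : comalg_on A) (b : comalg_on B)
    (d : comalg_on D) (f : A ~> B) (g : B ~> D) :
  is_alg_hom a b f -> is_alg_hom b d g -> is_alg_hom a d (f ;; g).
Proof.
move=> [fm fe] [gm ge]; split; last by rewrite compA fe.
by rewrite compA fm -compA gm compA tenM.
Qed.

Lemma comalg_on_eq (A : C) (a b : comalg_on A) :
  alg_m a = alg_m b -> alg_e a = alg_e b -> a = b.
Proof.
case: a b => [m e ? ? ? ?] [m' e' ? ? ? ?] /= em ee; subst m' e'.
by congr ComalgOn; exact: proof_irrelevance.
Qed.

Lemma alg_m1_of (A : C) (m : A ⊗ A ~> A) (e : kk ~> A) :
  (e ⊗₁ idc A) ;; m = lun A -> sym A A ;; m = m -> (idc A ⊗₁ e) ;; m = run A.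
Proof. by move=> e1 mC; rewrite -{1}mC compA sym_nat -compA e1 sym_unit. Qed.

Definition comalg_hom (A B : comalg C) : Type :=
  {f : calg_car A ~> calg_car B | is_alg_hom A B f}.

Lemma comalg_hom_eq (A B : comalg C) (f g : comalg_hom A B) :
  proj1_sig f = proj1_sig g -> f = g.
Proof.
by case: f g => f pf [g pg] /= e; subst g; congr exist; exact: proof_irrelevance.
Qed.

Definition Alg : category.
Proof.
apply: (@Category (comalg C) comalg_hom
  (fun A => exist _ (idc (calg_car A)) (is_alg_hom_id A))
  (fun A B D f g => exist _ (proj1_sig f ;; proj1_sig g)
     (is_alg_hom_comp (proj2_sig f) (proj2_sig g)))).
- by move=> A B f; apply: comalg_hom_eq; exact: comp1c.
- by move=> A B f; apply: comalg_hom_eq; exact: compc1.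
- by move=> A B D E f g h; apply: comalg_hom_eq; exact: compA.
Defined.

Definition forget : functor Alg C :=
  @Functor Alg C (fun A : comalg C => calg_car A)
    (fun A B (f : comalg_hom A B) => proj1_sig f)
    (fun A => erefl) (fun A B D f g => erefl).

(* A split epimorphism [a], with section [s], transports an algebra structure forward, provided
   it is compatible with the transported multiplication. *)
Section SplitQuotient.
Variables (B A : C) (b : comalg_on B) (s : A ~> B) (a : B ~> A).

Definition sq_m : A ⊗ A ~> A := (s ⊗₁ s) ;; alg_m b ;; a.
Definition sq_e : kk ~> A := alg_e b ;; a.

Hypothesis sa : s ;; a = idc A.
Hypothesis am : alg_m b ;; a = (a ⊗₁ a) ;; sq_m.

Lemma sq_1m : (sq_e ⊗₁ idc A) ;; sq_m = lun A.
Proof.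
have -> : sq_e ⊗₁ idc A = (idc kk ⊗₁ s) ;; ((alg_e b ⊗₁ idc B) ;; (a ⊗₁ a)).
  by rewrite -!tenM !comp1c sa.
rewrite -!compA -am [(alg_e b ⊗₁ _) ;; _]compA alg_1m compA lun_nat.
by rewrite -compA sa compc1.
Qed.

Lemma sq_mC : sym A A ;; sq_m = sq_m.
Proof. by rewrite /sq_m !compA -sym_nat -(compA _ (sym B B)) alg_mC. Qed.

Lemma sq_mA : asc A A A ;; (idc A ⊗₁ sq_m) ;; sq_m = (sq_m ⊗₁ idc A) ;; sq_m.
Proof.
have lift_l : (idc A ⊗₁ sq_m) ;; sq_m =
    (s ⊗₁ (s ⊗₁ s)) ;; (idc B ⊗₁ alg_m b) ;; alg_m b ;; a.
  rewrite -[RHS]compA am compA -!tenM; congr (_ ;; _).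
  by rewrite compc1 sa.
have lift_r : (sq_m ⊗₁ idc A) ;; sq_m =
    ((s ⊗₁ s) ⊗₁ s) ;; (alg_m b ⊗₁ idc B) ;; alg_m b ;; a.
  rewrite -[RHS]compA am compA -!tenM; congr (_ ;; _).
  by rewrite compc1 sa.
rewrite -compA lift_l lift_r !compA -asc_nat -!compA; congr (_ ;; _).
by rewrite !compA alg_mA.
Qed.

Definition split_quotient_alg : comalg_on A :=
  ComalgOn sq_mA sq_1m (alg_m1_of sq_1m sq_mC) sq_mC.

End SplitQuotient.

End AlgFacts.

Record amodule (C : symmetric_monoidal) (A : C) (a : comalg_on A) := Amodule {
  mod_car :> C;
  mod_act : A ⊗ mod_car ~> mod_car;
  mod_actA : asc A A mod_car ;; (idc A ⊗₁ mod_act) ;; mod_act =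
             (alg_m a ⊗₁ idc mod_car) ;; mod_act;
  mod_act1 : (alg_e a ⊗₁ idc mod_car) ;; mod_act = lun mod_car }.

Definition free_module (C : symmetric_monoidal) (A : C) (a : comalg_on A)
  (X : C) : amodule a.
Proof.
apply: (@Amodule C A a (A ⊗ X) (asci A A X ;; (alg_m a ⊗₁ idc X))).
- rewrite -{1}ten1 [in RHS]compA asci_nat tenf_r.
  have key : asc A A (A ⊗ X) ;; (idc A ⊗₁ asci A A X) =
      asci (A ⊗ A) A X ;; (asc A A A ⊗₁ idc X) ;; asc A (A ⊗ A) X.
    rewrite -[RHS]compc1 -ten1 -ascK tenf_r !compA.
    congr (_ ;; _); rewrite -[LHS]comp1c -asciK -!compA; congr (_ ;; _).
    by rewrite pentagon !compA.
  rewrite !compA key -[asci (A ⊗ A) A X ;; _ ;; _ ;; _]compA -asc_nat -!compA.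
  congr (_ ;; _); rewrite [asc A A X ;; _]compA ascK comp1c -!tenM comp1c.
  by rewrite compA alg_mA.
- rewrite -ten1 compA asci_nat -compA -tenM comp1c alg_1m -asc_lun compA asciK.
  exact: comp1c.
Defined.

Section SquareZero.
Variables (C : additive_smc) (P : finite_coproducts C).
Variables (A : C) (a : comalg_on A) (M : amodule a).

Let E := coprod P A M.
Let p1 : E ~> A := proj1_c P A M.
Let p2 : E ~> M := proj2_c P A M.

(* The algebra [A ⊕ M] in which the product of two elements of [M] is zero. *)
Definition sqz_m : E ⊗ E ~> E :=
  pair_c P ((p1 ⊗₁ p1) ;; alg_m a)
    (((p1 ⊗₁ p2) ;; mod_act M) ⊞ (sym E E ;; (p1 ⊗₁ p2) ;; mod_act M)).
Definition sqz_e : kk ~> E := pair_c P (alg_e a) zeroh.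

Let r : M ⊗ A ~> M := sym M A ;; mod_act M.

Lemma sqz_m1 : sqz_m ;; p1 = (p1 ⊗₁ p1) ;; alg_m a.
Proof. exact: pair_proj1. Qed.

Lemma sqz_m2 :
  sqz_m ;; p2 = ((p1 ⊗₁ p2) ;; mod_act M) ⊞ ((p2 ⊗₁ p1) ;; r).
Proof. by rewrite /sqz_m pair_proj2 -sym_nat -compA. Qed.

Let lr : asc A M A ;; (idc A ⊗₁ r) ;; mod_act M = (mod_act M ⊗₁ idc A) ;; r.
Proof.
rewrite /r compA sym_nat sym_hex -!compA; congr (_ ;; _).
rewrite tenf_r -!compA; congr (_ ;; _).
transitivity (asci A A M ;; ((alg_m a ⊗₁ idc M) ;; mod_act M)).
  by rewrite -mod_actA !compA asciK comp1c.
congr (_ ;; _); rewrite [asc A A M ;; _]compA mod_actA compA -tenM comp1c.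
by rewrite alg_mC.
Qed.

Let rr : asc M A A ;; (idc M ⊗₁ alg_m a) ;; r = (r ⊗₁ idc A) ;; r.
Proof.
transitivity ((sym M A ⊗₁ idc A) ;; (asc A M A ;; (idc A ⊗₁ r) ;; mod_act M)).
  rewrite /r -compA [(idc M ⊗₁ _) ;; _]compA sym_nat.
  have -> : asc M A A ;; (sym M (A ⊗ A) ;; (alg_m a ⊗₁ idc M) ;; mod_act M) =
    asc M A A ;; sym M (A ⊗ A) ;; asc A A M ;; ((idc A ⊗₁ mod_act M) ;; mod_act M).
    by rewrite -!compA -mod_actA -!compA.
  by rewrite hexagon tenf_r -!compA.
by rewrite lr compA -tenM comp1c.
Qed.

Lemma sqz_mA :
  asc E E E ;; (idc E ⊗₁ sqz_m) ;; sqz_m = (sqz_m ⊗₁ idc E) ;; sqz_m.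
Proof.
apply: pair_ext; rewrite -/p1 -/p2 -!compA.
  rewrite sqz_m1 !compA -[_ ;; _ ;; (p1 ⊗₁ p1)]compA -!tenM !comp1c sqz_m1.
  transitivity (((p1 ⊗₁ p1) ⊗₁ p1) ;; (asc A A A ;; (idc A ⊗₁ alg_m a) ;; alg_m a)).
    by rewrite !compA asc_nat -(compA _ _ (idc A ⊗₁ _)) -tenM compc1.
  by rewrite alg_mA compA -tenM compc1.
rewrite sqz_m2 !comphD ![(_ ⊗₁ _) ;; ((_ ⊗₁ _) ;; _)]compA -!tenM !comp1c.
rewrite sqz_m1 sqz_m2 tenhD tenDh !compDh !comphD addhA.
congr (_ ⊞ _ ⊞ _).
- transitivity (((p1 ⊗₁ p1) ⊗₁ p2) ;;
     (asc A A M ;; (idc A ⊗₁ mod_act M) ;; mod_act M)).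
    by rewrite !compA asc_nat -(compA _ _ (idc A ⊗₁ _)) -tenM compc1 -?compA /r ?compA.
  by rewrite mod_actA compA -tenM compc1.
- transitivity (((p1 ⊗₁ p2) ⊗₁ p1) ;;
     (asc A M A ;; (idc A ⊗₁ r) ;; mod_act M)).
    by rewrite !compA asc_nat -(compA _ _ (idc A ⊗₁ _)) -tenM compc1 -?compA /r ?compA.
  by rewrite lr compA -tenM compc1.
- transitivity (((p2 ⊗₁ p1) ⊗₁ p1) ;;
     (asc M A A ;; (idc M ⊗₁ alg_m a) ;; r)).
    by rewrite !compA asc_nat -(compA _ _ (idc M ⊗₁ _)) -tenM compc1 -?compA /r ?compA.
  by rewrite rr compA -tenM compc1.
Qed.

Lemma sqz_1m : (sqz_e ⊗₁ idc E) ;; sqz_m = lun E.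
Proof.
have e1 : sqz_e ;; p1 = alg_e a by exact: pair_proj1.
have e2 : sqz_e ;; p2 = zeroh by exact: pair_proj2.
apply: pair_ext; rewrite -/p1 -/p2 -!compA.
  rewrite sqz_m1 compA -tenM comp1c e1 -lun_nat -(alg_1m a) compA -tenM.
  by rewrite comp1c compc1.
rewrite sqz_m2 comphD !compA -!tenM !comp1c e1 e2 ten0h !comp0h addh0.
by rewrite -lun_nat -(mod_act1 M) compA -tenM comp1c compc1.
Qed.

Lemma sqz_mC : sym E E ;; sqz_m = sqz_m.
Proof.
apply: pair_ext; rewrite -/p1 -/p2 -!compA.
  by rewrite sqz_m1 compA -sym_nat -compA alg_mC.
rewrite sqz_m2 comphD /r !compA -!sym_nat addhC.
by rewrite -(compA _ (sym A M)) (symK A M) compc1.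
Qed.

Definition square_zero : comalg_on E :=
  ComalgOn sqz_mA sqz_1m (alg_m1_of sqz_1m sqz_mC) sqz_mC.

Lemma proj1_alg_hom : is_alg_hom square_zero a p1.
Proof. by split; [exact: sqz_m1 | exact: pair_proj1]. Qed.

End SquareZero.

(* A left adjoint of the forgetful functor from commutative algebras. *)
Record symmetric_algebras (C : symmetric_monoidal) := SymmetricAlgebras {
  free_alg : functor C (Alg C);
  free_adj : adjunction free_alg (forget C) }.

Section SymmetricAlgebra.
Variables (C : symmetric_monoidal) (S : symmetric_algebras C).
Implicit Types X Y : C.

Definition symM : monad C := adjunction_monad (free_adj S).

Definition sym_alg X : comalg_on (symM X) := calg_str (free_alg S X).

Definition sym_ext X (A : C) (a : comalg_on A) (f : X ~> A) : symM X ~> A :=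
  fmap symM f ;; proj1_sig (adj_counit (free_adj S) (Comalg a)).

Lemma sym_ext_hom X (A : C) (a : comalg_on A) (f : X ~> A) :
  is_alg_hom (sym_alg X) a (sym_ext a f).
Proof.
apply: is_alg_hom_comp (proj2_sig (adj_counit (free_adj S) (Comalg a))).
exact: (proj2_sig (fmap (free_alg S) f)).
Qed.

Lemma sym_ext_eta X (A : C) (a : comalg_on A) (f : X ~> A) :
  mon_eta symM X ;; sym_ext a f = f.
Proof.
have e := mon_eta_nat symM f.
rewrite /sym_ext compA -e /= -compA.
rewrite (adj_triangle_U (free_adj S) (Comalg a)).
exact: compc1.
Qed.

Lemma sym_ext_uniq X (A : C) (a : comalg_on A) (g : symM X ~> A) :
  is_alg_hom (sym_alg X) a g -> g = sym_ext a (mon_eta symM X ;; g).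
Proof.
move=> gh; rewrite /sym_ext fmapM -compA.
have e := adj_counit_nat (free_adj S)
  (exist _ g gh : @hom (Alg C) (free_alg S X) (Comalg a)).
move/(f_equal (@proj1_sig _ _)): e => /= ->; rewrite compA.
have := adj_triangle_F (free_adj S) X.
by move/(f_equal (@proj1_sig _ _)) => /= ->; rewrite comp1c.
Qed.

Lemma sym_hom_eq X (A : C) (a : comalg_on A) (g h : symM X ~> A) :
  is_alg_hom (sym_alg X) a g -> is_alg_hom (sym_alg X) a h ->
  mon_eta symM X ;; g = mon_eta symM X ;; h -> g = h.
Proof. by move=> gh hh e; rewrite (sym_ext_uniq gh) (sym_ext_uniq hh) e. Qed.

Lemma sym_map_hom X Y (f : X ~> Y) :
  is_alg_hom (sym_alg X) (sym_alg Y) (fmap symM f).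
Proof. exact: (proj2_sig (fmap (free_alg S) f)). Qed.

Lemma sym_mu_hom X : is_alg_hom (sym_alg (symM X)) (sym_alg X) (mon_mu symM X).
Proof. exact: (proj2_sig (adj_counit (free_adj S) (free_alg S X))). Qed.

Definition comparison (A : comalg C) : monad_algebra symM.
Proof.
apply: (@MonadAlgebra C symM A (proj1_sig (adj_counit (free_adj S) A))).
- exact: (adj_triangle_U (free_adj S)).
- have e := adj_counit_nat (free_adj S) (adj_counit (free_adj S) A).
  by move/(f_equal (@proj1_sig _ _)): e => /= ->.
Defined.

Lemma sym_act_m (A : monad_algebra symM) :
  alg_m (sym_alg A) ;; ta_act A =
  (ta_act A ⊗₁ ta_act A) ;;
  ((mon_eta symM A ⊗₁ mon_eta symM A) ;; alg_m (sym_alg A) ;; ta_act A).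
Proof.
have [Sm _] := sym_map_hom (ta_act A); have [mum _] := sym_mu_hom A.
have eN := mon_eta_nat symM (ta_act A); rewrite /= in eN.
rewrite !compA -tenM eN tenM -(compA _ _ (alg_m (sym_alg A))) -Sm.
rewrite -!compA -ta_mult [alg_m (sym_alg _) ;; (_ ;; _)]compA mum !compA.
by rewrite -tenM mon_unit_l ten1 comp1c.
Qed.

Definition comalg_of_sym (A : monad_algebra symM) : comalg_on A :=
  split_quotient_alg (ta_unit A) (sym_act_m A).

Lemma comalg_of_sym_act (A : monad_algebra symM) :
  is_alg_hom (sym_alg A) (comalg_of_sym A) (ta_act A).
Proof. by split; [exact: sym_act_m | exact: erefl]. Qed.

(* The next three lemmas make the comparison functor [Alg -> symM-algebras] an
   isomorphism with inverse [comalg_of_sym]. *)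
Lemma comparisonK (A : comalg C) : Comalg (comalg_of_sym (comparison A)) = A.
Proof.
case: A => A a; congr Comalg.
have [hm he] := proj2_sig (adj_counit (free_adj S) (Comalg a)).
have := adj_triangle_U (free_adj S) (Comalg a) => /= ht.
apply: comalg_on_eq => /=; last exact: he.
by rewrite /sq_m -compA hm compA -tenM ht ten1 comp1c.
Qed.

Lemma comalg_of_symK (A : monad_algebra symM) :
  comparison (Comalg (comalg_of_sym A)) = A.
Proof.
have e : proj1_sig (adj_counit (free_adj S) (Comalg (comalg_of_sym A))) = ta_act A.
  apply: (@sym_hom_eq _ _ (comalg_of_sym A)).
  - exact: (proj2_sig (adj_counit (free_adj S) (Comalg (comalg_of_sym A)))).
  - exact: comalg_of_sym_act.
  - rewrite ta_unit; exact: (adj_triangle_U (free_adj S) (Comalg (comalg_of_sym A))).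
case: A e => A a u m e; exact: monad_algebra_eq.
Qed.

Lemma comalg_of_sym_hom (A B : monad_algebra symM) (f : A ~> B) :
  is_alg_hom (comalg_of_sym A) (comalg_of_sym B) f <->
  ta_act A ;; f = fmap symM f ;; ta_act B.
Proof.
split=> [fh|fS].
  apply: (@sym_hom_eq _ _ (comalg_of_sym B)).
  - exact: is_alg_hom_comp (comalg_of_sym_act A) fh.
  - exact: is_alg_hom_comp (sym_map_hom f) (comalg_of_sym_act B).
  - rewrite !compA ta_unit -(mon_eta_nat symM f) /= -compA ta_unit.
    by rewrite comp1c compc1.
have [Sm Se] := sym_map_hom f.
split=> /=; last by rewrite -compA fS compA Se.
rewrite -!compA fS [alg_m _ ;; (_ ;; _)]compA Sm !compA -!tenM.
by have /= <- := mon_eta_nat symM f.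
Qed.

End SymmetricAlgebra.

Section DerivingTransform.
Variables (C : additive_smc) (P : finite_coproducts C)
  (S : symmetric_algebras C).

Definition sym_sqz (X : C) : comalg_on (coprod P (symM S X) (symM S X ⊗ X)) :=
  square_zero P (free_module (sym_alg S X) X).

Definition sym_gen (X : C) : X ~> coprod P (symM S X) (symM S X ⊗ X) :=
  pair_c P (mon_eta (symM S) X) (luni X ;; (alg_e (sym_alg S X) ⊗₁ idc X)).

(* The second component of the algebra homomorphism extending [sym_gen];
   [sym_dP] is its characterization through [<1, d>]. *)
Definition sym_d (X : C) : symM S X ~> symM S X ⊗ X :=
  sym_ext S (sym_sqz X) (sym_gen X) ;; proj2_c P _ _.

Lemma sym_dE (X : C) :
  pair_c P (idc (symM S X)) (sym_d X) = sym_ext S (sym_sqz X) (sym_gen X).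
Proof.
rewrite [RHS]pair_eta; congr pair_c.
apply: (@sym_hom_eq C S X _ (sym_alg S X)).
- exact: is_alg_hom_id.
- apply: (is_alg_hom_comp (sym_ext_hom S (sym_sqz X) (sym_gen X))).
  exact: (proj1_alg_hom P (free_module (sym_alg S X) X)).
- by rewrite compA sym_ext_eta compc1 pair_proj1.
Qed.

Lemma sym_dP (X : C) (d : symM S X ~> symM S X ⊗ X) :
  (is_alg_hom (sym_alg S X) (sym_sqz X) (pair_c P (idc _) d) /\
   mon_eta (symM S) X ;; pair_c P (idc _) d = sym_gen X) <-> d = sym_d X.
Proof.
split=> [[dh de]|->]; last first.
  by rewrite sym_dE; split; [exact: sym_ext_hom | exact: sym_ext_eta].
by rewrite /sym_d -de -(sym_ext_uniq dh) pair_proj2.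
Qed.

End DerivingTransform.

(* Naturality of [m] and [e] says exactly that each [fmap T f] is an algebra
   homomorphism. *)
Record algebra_modality (C : symmetric_monoidal) (T : monad C) :=
  AlgebraModality {
  am_alg :> forall X : C, comalg_on (T X);
  am_nat : forall (X Y : C) (f : X ~> Y),
    is_alg_hom (am_alg X) (am_alg Y) (fmap T f);
  am_mu : forall X : C, is_alg_hom (am_alg (T X)) (am_alg X) (mon_mu T X) }.

Section CanonicalBijection.
Variables (C : symmetric_monoidal) (S : symmetric_algebras C) (T : monad C).

Section OfModality.
Variable a : algebra_modality T.

(* The unique algebra homomorphism [S X -> T X] extending the unit of [T]. *)
Definition lambda_map (X : C) : symM S X ~> T X := sym_ext S (a X) (mon_eta T X).

Lemma lambda_map_hom X : is_alg_hom (sym_alg S X) (a X) (lambda_map X).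
Proof. exact: sym_ext_hom. Qed.

Lemma lambda_map_eta X : mon_eta (symM S) X ;; lambda_map X = mon_eta T X.
Proof. exact: sym_ext_eta. Qed.

Lemma lambda_map_nat : natural lambda_map.
Proof.
move: lambda_map lambda_map_hom lambda_map_eta => l lh le X Y f.
apply: (@sym_hom_eq _ S _ _ (a Y)).
- exact: is_alg_hom_comp (sym_map_hom S f) (lh Y).
- exact: is_alg_hom_comp (lh X) (am_nat a f).
- rewrite !compA le -(mon_eta_nat (symM S) f) -compA le.
  exact: (mon_eta_nat T f).
Qed.

Lemma lambda_map_mu X :
  mon_mu (symM S) X ;; lambda_map X =
  lambda_map (symM S X) ;; fmap T (lambda_map X) ;; mon_mu T X.
Proof.
move: lambda_map lambda_map_hom lambda_map_eta => l lh le.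
apply: (@sym_hom_eq _ S _ _ (a X)).
- exact: is_alg_hom_comp (sym_mu_hom S X) (lh X).
- apply: is_alg_hom_comp (am_mu a X).
  exact: is_alg_hom_comp (lh _) (am_nat a _).
- rewrite !compA mon_unit_l comp1c le.
  have /= <- := mon_eta_nat T (l X).
  by rewrite -compA mon_unit_l compc1.
Qed.

Definition lambda_of_modality : monad_morphism (symM S) T :=
  MonadMorphism lambda_map_nat lambda_map_eta lambda_map_mu.

End OfModality.

Section OfLambda.
Variable l : monad_morphism (symM S) T.

Definition sym_of_monad_algebra (A : monad_algebra T) : monad_algebra (symM S).
Proof.
apply: (@MonadAlgebra C (symM S) A (l A ;; ta_act A)).
- by rewrite compA mm_eta ta_unit.
- rewrite compA mm_mu -(compA _ (mon_mu T A)) ta_mult !compA fmapM.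
  rewrite -(compA _ _ (l A)) (mm_nat l (ta_act A)) !compA.
  by rewrite (mm_nat l (l A)).
Defined.

Definition free_monad_algebra (X : C) : monad_algebra T :=
  @MonadAlgebra C T (T X) (mon_mu T X) (mon_unit_l T X) (mon_assoc T X).

(* [T X] is the commutative algebra corresponding to the [symM]-algebra with
   structure map [l (T X) ;; mon_mu T X]. *)
Definition modality_of_lambda : algebra_modality T.
Proof.
apply: (@AlgebraModality C T
  (fun X => comalg_of_sym (sym_of_monad_algebra (free_monad_algebra X)))).
- move=> X Y f.
  apply/(@comalg_of_sym_hom _ _
     (sym_of_monad_algebra (free_monad_algebra X))
     (sym_of_monad_algebra (free_monad_algebra Y))) => /=.
  have /= el := mm_nat l (fmap T f); have /= em := mon_mu_nat T f.
  by rewrite compA el -!compA em.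
- move=> X.
  apply/(@comalg_of_sym_hom _ _
     (sym_of_monad_algebra (free_monad_algebra (T X)))
     (sym_of_monad_algebra (free_monad_algebra X))) => /=.
  have /= el := mm_nat l (mon_mu T X).
  by rewrite compA el -!compA mon_assoc.
Defined.

End OfLambda.
End CanonicalBijection.

Definition natural_d (C : symmetric_monoidal) (T : monad C)
    (d : forall X : C, T X ~> T X ⊗ X) : Prop :=
  forall (X Y : C) (f : X ~> Y), fmap T f ;; d Y = d X ;; (fmap T f ⊗₁ f).

(* A monad, an algebra modality on it and a natural [d], before any axiom
   relating [d] to the rest. *)
Record modality_data (C : symmetric_monoidal) := ModalityData {
  md_T : monad C;
  md_alg : algebra_modality md_T;
  md_d : forall X : C, md_T X ~> md_T X ⊗ X;
  md_d_nat : natural_d md_d }.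

Arguments md_d {C} m X : rename.

(* The component of [d] at [md_T D X] is the morphism out of [T (T X)]. *)
Definition chain_rule (C : symmetric_monoidal) (D : modality_data C) : Prop :=
  forall X : C,
    mon_mu (md_T D) X ;; md_d D X =
    md_d D (md_T D X) ;; (mon_mu (md_T D) X ⊗₁ md_d D X) ;;
    asci (md_T D X) (md_T D X) X ;; (alg_m (md_alg D X) ⊗₁ idc X).

(* In [cod_leibniz] the symmetry [TX ⊗ X ⊗ TX -> TX ⊗ TX ⊗ X] swaps the last two
   factors. Moving the last factor to the front instead gives the same
   composite, since [m] is commutative. *)
Record codifferential (C : additive_smc) (D : modality_data C) : Prop :=
  Codifferential {
  cod_const : forall X : C, alg_e (md_alg D X) ;; md_d D X = zeroh;
  cod_leibniz : forall X : C,
    let T := md_T D in let d := md_d D X in let m := alg_m (md_alg D X) in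
    m ;; d =
    ((idc (T X) ⊗₁ d) ;; asci (T X) (T X) X ;; (m ⊗₁ idc X)) ⊞
    ((d ⊗₁ idc (T X)) ;;
     (asc (T X) X (T X) ;; (idc (T X) ⊗₁ sym X (T X)) ;; asci (T X) (T X) X) ;;
     (m ⊗₁ idc X));
  cod_linear : forall X : C,
    mon_eta (md_T D) X ;; md_d D X =
    luni X ;; (alg_e (md_alg D X) ⊗₁ idc X);
  cod_chain : chain_rule D }.

Record lambda_data (C : symmetric_monoidal) (S : symmetric_algebras C) :=
  LambdaData {
  ld_T : monad C;
  ld_lambda : monad_morphism (symM S) ld_T;
  ld_d : forall X : C, ld_T X ~> ld_T X ⊗ X;
  ld_d_nat : natural_d ld_d }.

Arguments ld_d {C S} l X : rename.

Definition to_lambda (C : symmetric_monoidal) (S : symmetric_algebras C)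
    (D : modality_data C) : lambda_data S :=
  @LambdaData C S (md_T D) (lambda_of_modality S (md_alg D)) (md_d D)
    (@md_d_nat C D).

Definition to_modality (C : symmetric_monoidal) (S : symmetric_algebras C)
    (L : lambda_data S) : modality_data C :=
  @ModalityData C (ld_T L) (modality_of_lambda (ld_lambda L)) (ld_d L)
    (@ld_d_nat C S L).

Definition deriving_compatible (C : additive_smc) (P : finite_coproducts C)
    (S : symmetric_algebras C) (L : lambda_data S) : Prop :=
  forall X : C,
    ld_lambda L X ;; ld_d L X = sym_d P S X ;; (ld_lambda L X ⊗₁ idc X).

Definition lambda_codifferential (C : additive_smc) (P : finite_coproducts C)
    (S : symmetric_algebras C) (L : lambda_data S) : Prop :=
  deriving_compatible P L /\ chain_rule (to_modality L).

(* Main.v *)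
From mathcomp Require Import ssreflect ssrfun.
Require Import Defs.
From Stdlib Require Import ProofIrrelevance FunctionalExtensionality.

Set Implicit Arguments.
Unset Strict Implicit.
Unset Printing Implicit Defensive.

Local Open Scope cat_scope.

(** A morphism [d] satisfies (d1) and (d2) exactly when [<1, d>] is an algebra
homomorphism into the square-zero extension. Hence, in a codifferential
category, [<λ, λ;d>] and [<λ, d_S;(λ ⊗ 1)>] are algebra homomorphisms
[SC -> TC ⊕ TC ⊗ C] which agree on generators by (d3), and this is (a).
Conversely, (a) transports (d1) and (d3) from [S] along [λ]. For (d2), write
[m_TC = (η^S ⊗ η^S);m_S;λ_TC;μ_C]: the Chain Rule and (a) at [TC] reduce [m;d] to
[(η^S ⊗ η^S);m_S;d_S], which the Leibniz rule of [S] computes on generators. *)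

Lemma algebra_modality_eq (C : symmetric_monoidal) (T : monad C)
    (a b : algebra_modality T) : (forall X, a X = b X) -> a = b.
Proof.
case: a b => [a an am] [b bn bm] /= ab.
have e : a = b by exact: functional_extensionality_dep.
by subst b; congr AlgebraModality; exact: proof_irrelevance.
Qed.

Lemma monad_morphism_eq (C : category) (S T : monad C)
    (l k : monad_morphism S T) : (forall X, l X = k X) -> l = k.
Proof.
case: l k => [l ln le lm] [k kn ke km] /= lk.
have e : l = k by exact: functional_extensionality_dep.
by subst k; congr MonadMorphism; exact: proof_irrelevance.
Qed.

(** * The canonical bijection: both round trips *)

Section CanonicalBijectionInverse.
Variables (C : symmetric_monoidal) (S : symmetric_algebras C).

(** The composite [lambda_map ;; mon_mu] is an algebra homomorphism with section η^S, so it carries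
    products of generators to products in [T X]. The left side is the multiplication rebuilt from
    [lambda_of_modality]. *)
Lemma modality_mE (T : monad C) (a : algebra_modality T) (X : C) :
  (mon_eta (symM S) (T X) ⊗₁ mon_eta (symM S) (T X)) ;;
    alg_m (sym_alg S (T X)) ;; (lambda_map S a (T X) ;; mon_mu T X) =
  alg_m (a X).
Proof.
have [lm _] := lambda_map_hom S a (T X); have [mm _] := am_mu a X.
rewrite -compA [alg_m _ ;; (_ ;; _)]compA lm !compA -tenM lambda_map_eta.
by rewrite -compA mm compA -tenM mon_unit_l ten1 comp1c.
Qed.

Lemma modality_of_lambdaK (T : monad C) (a : algebra_modality T) :
  modality_of_lambda (lambda_of_modality S a) = a.
Proof.
apply: algebra_modality_eq => X.
have [_ le] := lambda_map_hom S a (T X); have [_ me] := am_mu a X.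
apply: comalg_on_eq; first exact: modality_mE.
by rewrite -me -le -compA.
Qed.

(** Puts [sym_alg] in a form to which [comalg_of_sym_hom] applies. *)
Lemma comalg_of_sym_free (X : C) :
  comalg_of_sym (free_monad_algebra (symM S) X) = sym_alg S X.
Proof.
have [mm me] := sym_mu_hom S X.
apply: comalg_on_eq => /=; last exact: me.
apply: etrans (esym (compA _ _ _)) _; rewrite mm compA -tenM.
apply: etrans (f_equal (fun h => (h ⊗₁ h) ;; _) (mon_unit_l (symM S) X)) _.
by rewrite ten1 comp1c.
Qed.

(** It suffices to commute with the S-actions. That square is [mm_mu], once naturality slides [l]
    past [fmap T (l X)]. *)
Lemma monad_morphism_alg_hom (T : monad C) (l : monad_morphism (symM S) T)
    (X : C) : is_alg_hom (sym_alg S X) (modality_of_lambda l X) (l X).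
Proof.
rewrite -comalg_of_sym_free; apply: (@comalg_of_sym_hom C S
  (free_monad_algebra (symM S) X)
  (sym_of_monad_algebra l (free_monad_algebra T X)) (l X)).2.
by apply: etrans (mm_mu l X) _; rewrite -(mm_nat l (l X)) -compA.
Qed.

Lemma lambda_of_modalityK (T : monad C) (l : monad_morphism (symM S) T) :
  lambda_of_modality S (modality_of_lambda l) = l.
Proof.
apply: monad_morphism_eq => X.
apply: (sym_hom_eq (lambda_map_hom S (modality_of_lambda l) X)
  (monad_morphism_alg_hom l X)).
by rewrite (lambda_map_eta S (modality_of_lambda l)) mm_eta.
Qed.

Lemma to_lambdaK : cancel (@to_lambda C S) (@to_modality C S).
Proof. by case=> T a d dn; rewrite /to_modality /= modality_of_lambdaK. Qed.

Lemma to_modalityK : cancel (@to_modality C S) (@to_lambda C S).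
Proof. by case=> T l d dn; rewrite /to_lambda /= lambda_of_modalityK. Qed.

End CanonicalBijectionInverse.

(** * Derivations and square-zero extensions *)

Section Derivations.
Variables (C : additive_smc) (P : finite_coproducts C).

(** Here [b] acts on [M] through [g]. The parameter [g] covers both [d] on [T X] (identity) and maps
    from [S X] to [T X ⊗ X] (along λ). *)
Definition is_derivation (B A : C) (b : comalg_on B) (a : comalg_on A)
    (M : amodule a) (g : B ~> A) (f : B ~> M) : Prop :=
  alg_m b ;; f =
    ((g ⊗₁ f) ;; mod_act M) ⊞ (sym B B ;; (g ⊗₁ f) ;; mod_act M) /\
  alg_e b ;; f = zeroh.

Arguments is_derivation {B A} b {a} M g f.

Lemma pair_comp (X A B D : C) (h : D ~> X) (f : X ~> A) (g : X ~> B) :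
  h ;; pair_c P f g = pair_c P (h ;; f) (h ;; g).
Proof. by rewrite /pair_c comphD !compA. Qed.

Lemma pair_hom_square_zero (B A : C) (b : comalg_on B) (a : comalg_on A)
    (M : amodule a) (g : B ~> A) (f : B ~> M) : is_alg_hom b a g ->
  is_alg_hom b (square_zero P M) (pair_c P g f) <-> is_derivation b M g f.
Proof.
move=> [gm ge].
have e2 : (pair_c P g f ⊗₁ pair_c P g f) ;; sqz_m P M ;; proj2_c P A M =
    ((g ⊗₁ f) ;; mod_act M) ⊞ (sym B B ;; (g ⊗₁ f) ;; mod_act M).
  rewrite -compA sqz_m2 comphD !compA -!tenM !pair_proj1 !pair_proj2.
  by rewrite sym_nat.
split=> [[hm he]|[fm fe]].
  split; first by rewrite -e2 -hm -compA pair_proj2.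
  by rewrite -(pair_proj2 P g f) compA he /= /sqz_e pair_proj2.
split=> /=; last by rewrite pair_comp ge fe.
apply: pair_ext; rewrite -compA ?pair_proj1 ?pair_proj2.
  by rewrite -[RHS]compA sqz_m1 compA -tenM pair_proj1.
by rewrite e2.
Qed.

(** The hexagon splits the symmetry into the swap of the last two factors and a swap of two copies
    of [A], which commutativity absorbs. This matches the second term of [is_derivation] with that
    of [cod_leibniz]. *)
Lemma sym_free_act (A : C) (a : comalg_on A) (X : C) :
  sym (A ⊗ X) A ;; mod_act (free_module a X) =
  (asc A X A ;; (idc A ⊗₁ sym X A) ;; asci A A X) ;; (alg_m a ⊗₁ idc X).
Proof.
rewrite /= sym_hex -!compA; congr (_ ;; (_ ;; (_ ;; _))).
by rewrite [asc A A X ;; _]compA ascK comp1c -tenM comp1c alg_mC.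
Qed.

Lemma sym_free_act_nat (A B : C) (a : comalg_on A) (X : C) (g : B ~> A)
    (f : B ~> A ⊗ X) :
  sym B B ;; (g ⊗₁ f) ;; mod_act (free_module a X) =
  (f ⊗₁ g) ;; (asc A X A ;; (idc A ⊗₁ sym X A) ;; asci A A X) ;;
  (alg_m a ⊗₁ idc X).
Proof. by rewrite -sym_nat -!compA sym_free_act -!compA. Qed.

(** In elements, a • (1 ⊗ x) = a ⊗ x: this evaluates Leibniz terms on generators. *)
Lemma free_act_unit (A : C) (a : comalg_on A) (X : C) :
  (idc A ⊗₁ (luni X ;; (alg_e a ⊗₁ idc X))) ;; mod_act (free_module a X) =
  idc (A ⊗ X).
Proof.
rewrite /= tenf_r -!compA [(_ ⊗₁ (alg_e a ⊗₁ _)) ;; _]compA asci_nat -!compA.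
rewrite -tenM comp1c alg_m1 -triangle [asci _ _ _ ;; _]compA asciK comp1c.
by rewrite -tenM comp1c luniK ten1.
Qed.

(** The map [g ⊗₁ idc X] is linear over [b], so composing a derivation with it gives a
    derivation. *)
Lemma derivation_push (B A : C) (b : comalg_on B) (a : comalg_on A) (X : C)
    (g : B ~> A) (d : B ~> B ⊗ X) : is_alg_hom b a g ->
  is_derivation b (free_module b X) (idc B) d ->
  is_derivation b (free_module a X) g (d ;; (g ⊗₁ idc X)).
Proof.
move=> [gm ge] [dm de].
have act : (alg_m b ⊗₁ idc X) ;; (g ⊗₁ idc X) =
    ((g ⊗₁ g) ⊗₁ idc X) ;; (alg_m a ⊗₁ idc X).
  by rewrite -!tenM gm comp1c.
have key : (g ⊗₁ (d ;; (g ⊗₁ idc X))) ;; mod_act (free_module a X) =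
    (idc B ⊗₁ d) ;; mod_act (free_module b X) ;; (g ⊗₁ idc X).
  rewrite /= -!compA act [asci _ _ _ ;; (_ ;; _)]compA -asci_nat !compA.
  by rewrite -tenM comp1c.
split; last by rewrite compA de comp0h.
rewrite compA dm compDh -!compA key;
by congr (_ ⊞ _); rewrite /= -!compA.
Qed.

End Derivations.

Arguments is_derivation {C B A} b {a} M g f.

(** * The deriving transform of S and the equivalence of axioms *)

Section Codifferential.
Variables (C : additive_smc) (P : finite_coproducts C)
  (S : symmetric_algebras C).

Lemma sym_d_derivation (X : C) :
  is_derivation (sym_alg S X) (free_module (sym_alg S X) X) (idc _)
    (sym_d P S X).
Proof.
apply/(pair_hom_square_zero P); first exact: is_alg_hom_id.
by have [] := (sym_dP P (sym_d P S X)).2 erefl.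
Qed.

Lemma sym_d_eta (X : C) :
  mon_eta (symM S) X ;; sym_d P S X =
  luni X ;; (alg_e (sym_alg S X) ⊗₁ idc X).
Proof.
have [_ /(f_equal (fun h => h ;; proj2_c P _ _))] :=
  (sym_dP P (sym_d P S X)).2 erefl.
by rewrite -compA !pair_proj2.
Qed.

(** In elements, d(xy) = x ⊗ y + y ⊗ x for generators, since d x = 1 ⊗ x. *)
Lemma sym_d_eta2 (X : C) :
  (mon_eta (symM S) X ⊗₁ mon_eta (symM S) X) ;; alg_m (sym_alg S X) ;;
    sym_d P S X =
  (mon_eta (symM S) X ⊗₁ idc X) ⊞
  (sym X X ;; (mon_eta (symM S) X ⊗₁ idc X)).
Proof.
have [dm _] := sym_d_derivation X.
have key : (mon_eta (symM S) X ⊗₁ mon_eta (symM S) X) ;;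
    (idc _ ⊗₁ sym_d P S X) ;; mod_act (free_module (sym_alg S X) X) =
    mon_eta (symM S) X ⊗₁ idc X.
  rewrite -tenM sym_d_eta compc1 -[Y in Y ⊗₁ _]compc1 -[Y in _ ⊗₁ Y]comp1c.
  by rewrite tenM -compA free_act_unit compc1.
rewrite /= !compA in key; rewrite -compA dm comphD /= !compA key sym_nat.
by rewrite -key !compA.
Qed.

Variable D : modality_data C.
Let T := md_T D.
Let a := md_alg D.
Let l := lambda_map S a.
Let l_hom X : is_alg_hom (sym_alg S X) (a X) (l X) := lambda_map_hom S a X.
Let l_eta X : mon_eta (symM S) X ;; l X = mon_eta T X := lambda_map_eta S a X.

Lemma is_derivation_dP (X : C) :
  is_derivation (a X) (free_module (a X) X) (idc _) (md_d D X) <->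
  alg_e (a X) ;; md_d D X = zeroh /\
  alg_m (a X) ;; md_d D X =
    ((idc (T X) ⊗₁ md_d D X) ;; asci (T X) (T X) X ;; (alg_m (a X) ⊗₁ idc X)) ⊞
    ((md_d D X ⊗₁ idc (T X)) ;;
     (asc (T X) X (T X) ;; (idc (T X) ⊗₁ sym X (T X)) ;; asci (T X) (T X) X) ;;
     (alg_m (a X) ⊗₁ idc X)).
Proof.
rewrite /is_derivation sym_free_act_nat /= !compA.
by split=> [[]|[]].
Qed.

Lemma codifferential_compatible :
  codifferential D -> deriving_compatible P (to_lambda S D).
Proof.
move=> cod X; change (l X ;; md_d D X = sym_d P S X ;; (l X ⊗₁ idc X)).
have lh := l_hom X.
have [dm de] : is_derivation (a X) (free_module (a X) X) (idc _) (md_d D X).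
  apply/is_derivation_dP; split; [exact: cod_const | exact: cod_leibniz].
have [lm le] := lh.
(* A derivation precomposed with an algebra homomorphism is a derivation along it. *)
have h1 : is_derivation (sym_alg S X) (free_module (a X) X) (l X)
    (l X ;; md_d D X).
  split; last by rewrite compA le de.
  rewrite compA lm -compA dm comphD !compA.
  by rewrite sym_nat -(compA _ (l X ⊗₁ l X)) -!tenM !compc1.
have h2 := derivation_push lh (sym_d_derivation X).
(* Both sides become second components of pairings with [l X], so that uniqueness of homomorphisms
   out of [S X] applies. *)
apply: etrans (pair_proj2 P (l X) _); rewrite -(pair_proj2 P (l X) (l X ;; _)).
congr (_ ;; _).
apply: (sym_hom_eq ((pair_hom_square_zero P _ lh).2 h1)
  ((pair_hom_square_zero P _ lh).2 h2)).
rewrite !pair_comp; congr pair_c.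
rewrite compA l_eta [RHS]compA sym_d_eta (cod_linear cod) -compA -tenM.
by rewrite comp1c le.
Qed.

Lemma compatible_codifferential :
  deriving_compatible P (to_lambda S D) -> chain_rule D -> codifferential D.
Proof.
move=> compat chain.
have l_d X : l X ;; md_d D X = sym_d P S X ;; (l X ⊗₁ idc X) := compat X.
have const X : alg_e (a X) ;; md_d D X = zeroh.
  have [_ de] := sym_d_derivation X.
  by rewrite -(l_hom X).2 -compA l_d compA de comp0h.
split=> //.
(* In the form of [is_derivation], the second summand is the first preceded by a symmetry, as in
   [sym_d_eta2]. *)
- move=> X; apply: (proj2 (proj1 (is_derivation_dP X) _)); split;
    last exact: const.
  (* What the Chain Rule and (a) at [T X] leave of each summand, before multiplying. *)
  have key : (mon_eta (symM S) (T X) ⊗₁ idc (T X)) ;; (l (T X) ⊗₁ idc (T X)) ;;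
      (mon_mu T X ⊗₁ md_d D X) = idc (T X) ⊗₁ md_d D X.
    by rewrite -!tenM l_eta mon_unit_l !comp1c.
  rewrite -{1}(modality_mE S a X) -/(l (T X)) -compA -(compA (l (T X))) chain.
  rewrite 3!(compA (l (T X))) l_d 4!(compA (_ ;; alg_m _)) sym_d_eta2 !compDh.
  by rewrite -!(compA (sym _ _)) !key /= !compA.
- move=> X.
  rewrite -l_eta -compA l_d compA sym_d_eta -compA -tenM.
  by rewrite comp1c (l_hom X).2.
Qed.

Lemma codifferential_iff :
  codifferential D <-> lambda_codifferential P (to_lambda S D).
Proof.
rewrite /lambda_codifferential to_lambdaK.
split=> [cod|[]]; last exact: compatible_codifferential.
by split; [exact: codifferential_compatible | exact: cod_chain].
Qed.

End Codifferential.

Theorem theorem5p1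
  (C : additive_smc) (P : finite_coproducts C) (S : symmetric_algebras C)
  (hcoeq : has_reflexive_coequalizers C)
  (hten : tensor_preserves_reflexive_coequalizers C) :
  cancel (@to_lambda C S) (@to_modality C S) /\
  cancel (@to_modality C S) (@to_lambda C S) /\
  (forall D : modality_data C,
     codifferential D <-> lambda_codifferential P (to_lambda S D)) /\
  (forall L : lambda_data S,
     lambda_codifferential P L <-> codifferential (to_modality L)).
Proof.
split; first exact: to_lambdaK.
split; first exact: to_modalityK.
split=> [D|L]; first exact: codifferential_iff.
(* The previous equivalence at [to_modality L], transported along the round trip. *)
rewrite -{1}(to_modalityK L).
exact: iff_sym (codifferential_iff P S (to_modality L)).
Qed.
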